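(* Let $G=(V_1\cup V_2,E)$ be a bipartite graph with parts $V_1,V_2$, $|V_1|=|V_2|=n$, $m=|E|$, and $V=V_1\cup V_2$. There is an algorithm that computes the vector $W'=(W'[0],\dots,W'[m])$, where $W'[k]=|\{S\subseteq V : |c(S,V\setminus S)|=k\}|$, in time $O^{\ast}(2^n)$.
   Context: For disjoint vertex sets $A,B$, $c(A,B)$ denotes the set of edges with one endpoint in $A$ and the other in $B$. $O^{\ast}$ denotes big-O with polynomial factors in $n$ suppressed. Arithmetic on the integer entries of $W'$ is counted as in the standard RAM model up to polynomial factors. *)

(* Defs.v *)
From mathcomp Require Import all_boot.

Set Implicit Arguments.
Unset Strict Implicit.
Unset Printing Implicit Defensive.

Record bigraph : Type := Bigraph {
  vertex : finType;
  part1 : {set vertex};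
  part2 : {set vertex};
  edges : {set {set vertex}};
  parts_cover : part1 :|: part2 = [set: vertex];
  parts_disjoint : [disjoint part1 & part2];
  edges_across : forall e, e \in edges ->
    exists x y, [/\ x \in part1, y \in part2 & e = [set x; y]]
}.

Definition cut (G : bigraph) (A B : {set vertex G}) : {set {set vertex G}} :=
  [set e in edges G | [exists x in A, exists y in B, e == [set x; y]]].

Definition cut_count (G : bigraph) (k : nat) : nat :=
  #|[set S : {set vertex G} | #|cut S (~: S)| == k]|.

Definition cut_vector (G : bigraph) : seq nat :=
  [seq cut_count G k | k <- iota 0 #|edges G|.+1].

(* The size of the first part, followed by the biadjacency matrix in row-major
   order.  Both parts have the same size in every use, so it is given once. *)
Definition encode (G : bigraph) : seq nat :=
  #|part1 G| ::
    [seq nat_of_bool ([set x; y] \in edges G)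
       | x <- enum (part1 G), y <- enum (part2 G)].

(* Random access machine of Cook and Reckhow, with natural-number registers,
   truncated subtraction, a read-once input tape and a write-once output tape.
   Time is measured by the logarithmic cost criterion, so that arithmetic on
   large integers is not free. X_i stands for the content of register i. *)
Inductive instr : Type :=
  | IConst of nat & nat          (* X_i <- c            *)
  | IAdd of nat & nat & nat      (* X_i <- X_j + X_k    *)
  | ISub of nat & nat & nat      (* X_i <- X_j - X_k    *)
  | ILoad of nat & nat           (* X_i <- X_(X_j)      *)
  | IStore of nat & nat          (* X_(X_i) <- X_j      *)
  | IJump of nat & nat           (* if X_i > 0 go to l  *)
  | IRead of nat                 (* X_i <- next input   *)
  | IPrint of nat.               (* output X_i          *)

Definition program := seq instr.

Record config : Type := Config {
  pc : nat;
  reg : nat -> nat;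
  input : seq nat;
  output : seq nat
}.

Definition init (w : seq nat) : config := Config 0 (fun=> 0) w [::].

Definition upd (r : nat -> nat) (i v : nat) : nat -> nat :=
  fun j => if j == i then v else r j.

(* Reading past the end of the input yields 0. *)
Definition step (a : instr) (s : config) : config :=
  let: Config p r w o := s in
  match a with
  | IConst i c => Config p.+1 (upd r i c) w o
  | IAdd i j k => Config p.+1 (upd r i (r j + r k)) w o
  | ISub i j k => Config p.+1 (upd r i (r j - r k)) w o
  | ILoad i j => Config p.+1 (upd r i (r (r j))) w o
  | IStore i j => Config p.+1 (upd r (r i) (r j)) w o
  | IJump i l => Config (if 0 < r i then l else p.+1) r w o
  | IRead i => Config p.+1 (upd r i (head 0 w)) (behead w) o
  | IPrint i => Config p.+1 r w (rcons o (r i))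
  end.

(* Length of the binary representation, with len 0 = 1. *)
Definition len (x : nat) : nat := (trunc_log 2 x).+1.

Definition cost (a : instr) (s : config) : nat :=
  let r := reg s in
  match a with
  | IConst i c => len c
  | IAdd i j k => len (r j) + len (r k)
  | ISub i j k => len (r j) + len (r k)
  | ILoad i j => len (r j) + len (r (r j))
  | IStore i j => len (r i) + len (r j)
  | IJump i l => len (r i)
  | IRead i => len (head 0 (input s))
  | IPrint i => len (r i)
  end.

(* [exec P s t o]: started in s, the program P halts, by moving its program
   counter past the last instruction, after time t and with output o. *)
Inductive exec (P : program) : config -> nat -> seq nat -> Prop :=
  | exec_halt s : onth P (pc s) = None -> exec P s 0 (output s)
  | exec_step s a t o :
      onth P (pc s) = Some a -> exec P (step a s) t o ->
      exec P s (cost a s + t) o.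

Definition computes_within (P : program) (w o : seq nat) (b : nat) : Prop :=
  exists2 t, t <= b & exec P (init w) t o.

Definition Ostar (f g : nat -> nat) : Prop :=
  exists c d N, forall n, N <= n -> f n <= c * n ^ d * g n.

(* Main.v *)
Require Import Defs.
From mathcomp Require Import all_boot.
From mathcomp Require Import zify.

(** Write X = 2^(2n+1).  Fix S2 = S :&: V2.  A vertex x of V1 put in S leaves
    a_x edges uncut (those going to S2), a vertex outside S leaves b_x edges
    uncut (those going to V2 :\: S2), so summing X^(number of uncut edges) over
    all S with this trace gives the product over x of (X^a_x + X^b_x).  Summing
    over the 2^n choices of S2 yields one big integer
      sum_S X^(m - |c(S, V \ S)|) = sum_k W'[k] X^(m-k),
    and W'[k] <= 2^(2n) < X, so that its base-X digits, most significant first,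
    are the entries of W'.  All integers involved have O(n^3) bits, hence the
    logarithmic cost only adds a polynomial factor.

    The machine never uses indirect addressing: the biadjacency matrix is packed
    in one integer, and bits are read off the top of a word by doubling it. *)

Set Implicit Arguments.
Unset Strict Implicit.
Unset Printing Implicit Defensive.

(** * Structured programs and their compilation *)

(** There is no conditional: a [Loop] on a counter that is 0 or 1 takes its place. *)
Inductive cmd : Type :=
  | Block of seq instr
  | Seq of cmd & cmd
  | Loop of nat & cmd.

Fixpoint csize (c : cmd) : nat :=
  match c with
  | Block b => size b
  | Seq c1 c2 => csize c1 + csize c2
  | Loop _ c => csize c + 4
  end.

(* [Loop i c] repeats [c; X_i <- X_i - 1] while X_i > 0.  Register 0 holds 1
   throughout, so a jump on it is unconditional. *)
Fixpoint compile (p : nat) (c : cmd) : program :=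
  match c with
  | Block b => b
  | Seq c1 c2 => compile p c1 ++ compile (p + csize c1) c2
  | Loop i c =>
      [:: IJump i p.+2; IJump 0 (p + (csize c + 4))] ++
      compile p.+2 c ++ [:: ISub i i 0; IJump 0 p]
  end.

Lemma size_compile c p : size (compile p c) = csize c.
Proof.
elim: c p => [b|c1 IH1 c2 IH2|i c IH] p //=.
  by rewrite size_cat IH1 IH2.
by rewrite size_cat IH /= addn2 addn4.
Qed.

(* Registers as a finite list padded with zeros, remaining input, output. *)
Definition state : Type := seq nat * seq nat * seq nat.

Definition eval (a : instr) (s : state) : state :=
  let: (l, w, o) := s in
  match a with
  | IConst i c => (set_nth 0 l i c, w, o)
  | IAdd i j k => (set_nth 0 l i (nth 0 l j + nth 0 l k), w, o)
  | ISub i j k => (set_nth 0 l i (nth 0 l j - nth 0 l k), w, o)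
  | IRead i => (set_nth 0 l i (head 0 w), behead w, o)
  | IPrint i => (l, w, rcons o (nth 0 l i))
  | _ => s
  end.

(** Jumps and indirect addressing are refused, so a block runs straight through. Truncated
    subtraction never exceeds its first operand and needs no check. *)
Definition fits (M : nat) (a : instr) (s : state) : bool :=
  let: (l, w, _) := s in
  match a with
  | IConst i c => c <= M
  | IAdd i j k => nth 0 l j + nth 0 l k <= M
  | ISub _ _ _ => true
  | IRead i => head 0 w <= M
  | IPrint _ => true
  | _ => false
  end.

Arguments eval !a !s /.
Arguments fits M !a !s /.

Fixpoint evals (b : seq instr) (s : state) : state :=
  if b is a :: b' then evals b' (eval a s) else s.

Fixpoint all_fit (M : nat) (b : seq instr) (s : state) : bool :=
  if b is a :: b' then fits M a s && all_fit M b' (eval a s) else true.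

(* [run M c T s s']: c leads from s to s' in at most T instructions, and never
   writes a value above M, so that every instruction costs at most 2 len M. *)
Inductive run (M : nat) : cmd -> nat -> state -> state -> Prop :=
  | run_block b T s : all_fit M b s -> size b <= T -> run M (Block b) T s (evals b s)
  | run_seq c1 c2 T1 T2 T s1 s2 s3 :
      run M c1 T1 s1 s2 -> run M c2 T2 s2 s3 -> T1 + T2 <= T ->
      run M (Seq c1 c2) T s1 s3
  | run_stop i c T s :
      nth 0 s.1.1 0 = 1 -> nth 0 s.1.1 i = 0 -> 2 <= T -> run M (Loop i c) T s s
  | run_iter i c T1 T2 T s1 s2 s3 :
      nth 0 s1.1.1 i > 0 -> run M c T1 s1 s2 -> nth 0 s2.1.1 0 = 1 ->
      i != 0 ->
      run M (Loop i c) T2 (eval (ISub i i 0) s2) s3 ->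
      T1 + T2 + 3 <= T -> run M (Loop i c) T s1 s3.

(** * Cost of compiled programs *)

Lemma leq_len x y : x <= y -> len x <= len y.
Proof. by move=> lexy; rewrite /len ltnS leq_trunc_log. Qed.

Definition represents (M : nat) (r : nat -> nat) (l : seq nat) : Prop :=
  forall j, r j = nth 0 l j /\ r j <= M.

Lemma represents_upd M r l i v :
  represents M r l -> v <= M -> represents M (upd r i v) (set_nth 0 l i v).
Proof.
move=> rep lev j; rewrite /upd nth_set_nth /=.
by case: eqP => // _; apply: rep.
Qed.

(** The bound [M] on all registers, part of [represents], limits each of the at most two operands to
    [len M] bits; [fits] does the same for constants and inputs. *)
Lemma eval_step M a r l w o p :
  represents M r l -> fits M a (l, w, o) ->
  exists2 r', represents M r' (eval a (l, w, o)).1.1 &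
    step a (Config p r w o) =
      Config p.+1 r' (eval a (l, w, o)).1.2 (eval a (l, w, o)).2 /\
    cost a (Config p r w o) <= 2 * len M.
Proof.
move=> rep; have lenr j : len (r j) <= len M by apply/leq_len/(rep j).2.
have len2 j k : len (r j) + len (r k) <= 2 * len M.
  by rewrite mul2n -addnn leq_add.
have leD x : x <= len M -> x <= 2 * len M by lia.
case: a => [i c|i j k|i j k|i j|i j|i k|i|i] //= fit.
- exists (upd r i c); first exact: represents_upd.
  by split=> //; apply/leD/leq_len.
- exists (upd r i (r j + r k)); rewrite ?(rep j).1 ?(rep k).1.
    exact: represents_upd.
  by split=> //; rewrite -(rep j).1 -(rep k).1.
- exists (upd r i (r j - r k)); last by [].
  rewrite (rep j).1 (rep k).1; apply: represents_upd => //.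
  by rewrite -(rep j).1 (leq_trans (leq_subr _ _)) // (rep j).2.
- exists (upd r i (head 0 w)); first exact: represents_upd.
  by split=> //; apply/leD/leq_len.
- exists r => //; rewrite (rep i).1; split=> //.
  by rewrite -(rep i).1; apply: leD.
Qed.

Lemma onth_at (s1 s2 : program) (a : instr) :
  onth (s1 ++ a :: s2) (size s1) = Some a.
Proof. by elim: s1. Qed.

(** [exec] only describes runs that halt, so a partial run is expressed as a way to prolong any
    halting run backwards. *)
Definition leads (P : program) (s s' : config) (b : nat) : Prop :=
  exists2 t, t <= b & forall t' out, exec P s' t' out -> exec P s (t + t') out.

Lemma leads_refl P s b : leads P s s b.
Proof. by exists 0. Qed.

Lemma leads_trans P s1 s2 s3 b1 b2 :
  leads P s1 s2 b1 -> leads P s2 s3 b2 -> leads P s1 s3 (b1 + b2).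
Proof.
move=> [t1 le1 lead1] [t2 le2 lead2]; exists (t1 + t2); first exact: leq_add.
by move=> t' out /lead2/lead1; rewrite addnA.
Qed.

Lemma leads_weaken P s s' b b' : b <= b' -> leads P s s' b -> leads P s s' b'.
Proof. by move=> leb [t let' lead]; exists t => //; apply: leq_trans leb. Qed.

Lemma leads_step P pre a post s b :
  P = pre ++ a :: post -> pc s = size pre -> cost a s <= b ->
  leads P s (step a s) b.
Proof.
move=> defP defp leb; exists (cost a s) => // t' out ex.
by apply: exec_step ex; rewrite defP defp onth_at.
Qed.

Lemma leads_jump M P pre post i q r l w o p :
  P = pre ++ IJump i q :: post -> p = size pre -> represents M r l ->
  leads P (Config p r w o) (Config (if 0 < r i then q else p.+1) r w o) (len M).
Proof.
move=> defP defp rep.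
by apply: (leads_step (s := Config p r w o) defP defp); apply/leq_len/(rep i).2.
Qed.

Lemma evals_leads M b r l w o pre post :
  represents M r l -> all_fit M b (l, w, o) ->
  exists2 r', represents M r' (evals b (l, w, o)).1.1 &
    leads (pre ++ b ++ post) (Config (size pre) r w o)
      (Config (size pre + size b) r' (evals b (l, w, o)).1.2 (evals b (l, w, o)).2)
      (size b * (2 * len M)).
Proof.
elim: b r l w o pre => [|a b IH] r l w o pre rep /=.
  by move=> _; exists r => //; rewrite addn0; apply: leads_refl.
case/andP=> fit_a; have [r1 rep1 [stepE costE]] := eval_step (size pre) rep fit_a.
have lead1 := @leads_step _ pre a (b ++ post) (Config (size pre) r w o) _ erefl erefl costE.
move: lead1; rewrite stepE => lead1 {stepE costE}.
case: (eval a (l, w, o)) rep1 lead1 => [[l1 w1] o1] /= rep1 lead1 fit_b.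
have [r2 rep2 lead2] := IH _ _ _ _ (rcons pre a) rep1 fit_b; exists r2 => //.
rewrite mulSn; apply: leads_trans lead1 _.
by move: lead2; rewrite size_rcons addSnnS cat_rcons.
Qed.

(** Induction on [run], with [pre] and [post] arbitrary so that each subcommand can be located
    inside the whole program. *)
Lemma run_leads M c T s s' : run M c T s s' ->
  forall P pre post r, P = pre ++ compile (size pre) c ++ post ->
  represents M r s.1.1 ->
  exists2 r', represents M r' s'.1.1 &
    leads P (Config (size pre) r s.1.2 s.2)
      (Config (size pre + csize c) r' s'.1.2 s'.2) (T * (2 * len M)).
Proof.
elim=> {c T s s'}.
- move=> b T [[l w] o] fit leT P pre post r -> /= rep.
  have [r' rep' lead] := evals_leads pre post rep fit.
  by exists r' => //; apply: leads_weaken lead; rewrite leq_mul2r leT orbT.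
- move=> c1 c2 T1 T2 T s1 s2 s3 _ IH1 _ IH2 leT P pre post r defP rep.
  have [|r1 rep1 lead1] := IH1 P pre (compile (size pre + csize c1) c2 ++ post) r _ rep.
    by rewrite defP /= -catA.
  have szE : size (pre ++ compile (size pre) c1) = size pre + csize c1.
    by rewrite size_cat size_compile.
  have [|r2 rep2] := IH2 P (pre ++ compile (size pre) c1) post r1 _ rep1.
    by rewrite szE defP /= -!catA.
  rewrite szE => lead2; exists r2 => //=.
  rewrite addnA; apply: leads_weaken (leads_trans lead1 lead2).
  by rewrite -mulnDl leq_mul2r leT orbT.
- move=> i c T [[l w] o] /= l0 li leT P pre post r defP rep.
  have [r0 ri] : r 0 = 1 /\ r i = 0 by rewrite (rep 0).1 (rep i).1.
  exists r => //.
  (* Leaving the loop takes two jumps: the failed test falls through to the unconditional jump. *)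
  apply: (@leads_weaken _ _ _ (len M + len M)).
    by rewrite addnn -mul2n leq_pmull //; lia.
  apply: leads_trans (leads_jump _ _ defP erefl rep) _; rewrite ri /=.
  have defP1 : P = rcons pre (IJump i (size pre).+2) ++
      IJump 0 (size pre + (csize c + 4)) ::
      compile (size pre).+2 c ++ [:: ISub i i 0; IJump 0 (size pre)] ++ post.
    by rewrite defP cat_rcons /= -catA.
  have := leads_jump w o defP1 (esym (size_rcons _ _)) rep.
  by rewrite r0.
- move=> i c T1 T2 T [[l1 w1] o1] [[l2 w2] o2] s3 /= li _ IH1 l20 i0 _ IH2 leT
    P pre post r defP rep.
  pose p := size pre.
  pose pre1 := pre ++ [:: IJump i p.+2; IJump 0 (p + (csize c + 4))].
  have pre1E : size pre1 = p.+2 by rewrite size_cat addn2.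
  have [|r1 rep1] := IH1 P pre1 ([:: ISub i i 0; IJump 0 p] ++ post) r _ rep.
    by rewrite pre1E defP /pre1 /= -!catA /= -?catA.
  rewrite pre1E => lead1.
  pose pre2 := pre1 ++ compile p.+2 c.
  have pre2E : size pre2 = p.+2 + csize c by rewrite size_cat pre1E size_compile.
  have defP2 : P = pre2 ++ ISub i i 0 :: IJump 0 p :: post.
    by rewrite defP /pre2 /pre1 -!catA /= -?catA.
  have [r2 rep2 [step2 cost2]] :=
    @eval_step M (ISub i i 0) r1 l2 w2 o2 (size pre2) rep1 isT.
  have defP3 : P = rcons pre2 (ISub i i 0) ++ IJump 0 p :: post.
    by rewrite cat_rcons.
  have [|r3 rep3 lead3] := IH2 P pre post r2 defP.
    by [].
  exists r3 => //.
  (* The summands pay for the test, the body, the decrement, the jump back and the remaining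
     iterations. *)
  apply: (@leads_weaken _ _ _ (len M + (T1 * (2 * len M) + (2 * len M + (len M + T2 * (2 * len M)))))).
    apply: leq_trans (leq_mul leT (leqnn _)); lia.
  apply: leads_trans (leads_jump _ _ defP erefl rep) _.
  rewrite (rep i).1 li; apply: leads_trans lead1 _ => /=.
  rewrite -pre2E.
  have lead2 := leads_step (s := Config _ _ _ _) defP2 erefl cost2.
  apply: leads_trans lead2 _; rewrite step2.
  apply: leads_trans (leads_jump _ _ defP3 (esym (size_rcons _ _)) rep2) _.
  by rewrite (rep2 0).1 /= nth_set_nth /= eq_sym (negPf i0) l20.
Qed.

Lemma run_computes M c T w l o : run M c T (nseq 22 0, w, [::]) (l, [::], o) ->
  computes_within (compile 0 c) w o (T * (2 * len M)).
Proof.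
move=> R; have [] := run_leads R (P := compile 0 c) (pre := [::]) (post := [::]) (r := fun=> 0).
- by rewrite cats0.
- by move=> j; rewrite nth_nseq if_same.
move=> r' _ [t let' lead]; exists (t + 0); first by rewrite addn0.
(* The program counter now equals the length of the program, so the machine halts at no further
   cost. *)
apply/lead/(@exec_halt _ (Config _ _ _ _)) => /=.
by rewrite add0n -(size_compile c 0); elim: (compile 0 c).
Qed.

Lemma run_weaken M c T T' s s' : T <= T' -> run M c T s s' -> run M c T' s s'.
Proof.
move=> leT R; case: R leT => {c T s s'}.
- by move=> b T s fit leb leT; apply: run_block (leq_trans leb leT).
- by move=> c1 c2 T1 T2 T s1 s2 s3 R1 R2 leb leT; apply: run_seq R1 R2 (leq_trans leb leT).
- by move=> i c T s e0 ei leb leT; apply: run_stop (leq_trans leb leT).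
- move=> i c T1 T2 T s1 s2 s3 gt R1 e0 i0 R2 leb leT.
  exact: run_iter gt R1 e0 i0 R2 (leq_trans leb leT).
Qed.

Lemma run_block_eq M b T s s' :
  all_fit M b s -> evals b s = s' -> size b <= T -> run M (Block b) T s s'.
Proof. by move=> fit <-; apply: run_block. Qed.

(* [S j q] is the state after j iterations, with q iterations left. *)
Lemma run_loop M i c T k (S : nat -> nat -> state) :
  i != 0 ->
  (forall j q, nth 0 (S j q).1.1 0 = 1) ->
  (forall j q, nth 0 (S j q).1.1 i = q) ->
  (forall j q, eval (ISub i i 0) (S j q.+1) = S j q) ->
  (forall j q, j + q.+1 = k -> run M c T (S j q.+1) (S j.+1 q.+1)) ->
  run M (Loop i c) (k * (T + 3) + 2) (S 0 k) (S k 0).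
Proof.
move=> i0 S0 Si Sdec body.
(* Each iteration adds 3 to its body for the test, the decrement and the jump back; the final exit
   takes 2. *)
have gen q : forall j, j + q = k -> run M (Loop i c) (q * (T + 3) + 2) (S j q) (S k 0).
  elim: q => [|q IH] j jq.
    by rewrite -jq addn0; apply: run_stop.
  apply: (@run_iter _ _ _ T (q * (T + 3) + 2) _ _ (S j.+1 q.+1)) => //.
  - by rewrite Si.
  - exact: body.
  - by rewrite Sdec; apply: IH; rewrite addSnnS.
  by rewrite mulSn; lia.
exact: gen.
Qed.

(** * The program *)

(** Register 0 holds 1, and the truncated [1 - (H - 2N)] is 1 exactly when [2N >= H]: it is the bit
    shifted out. The loop on its copy in register 19 then removes [H] at most once. *)
Definition shift (N H b : nat) : cmd :=
  Seq (Block [:: IAdd N N N; ISub 19 H N; ISub b 0 19; IAdd 19 b 22])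
      (Loop 19 (Block [:: ISub N N H])).

(** Register 2 holds [2n + 1], so these doublings multiply by [X]. *)
Definition mulX (a : nat) : cmd :=
  Seq (Block [:: IAdd 21 2 22]) (Loop 21 (Block [:: IAdd a a a])).

(** [F] is the register file as a function of the three registers that [shift] writes: [N], [b] and
    19. The read and write laws hold by computation for concrete files, so that one statement covers
    every use. *)
Lemma run_shift M N H b (F : nat -> nat -> nat -> seq nat) vN vH vb w o :
  N != 19 ->
  (forall x y z, nth 0 (F x y z) 0 = 1) -> (forall x y z, nth 0 (F x y z) N = x) ->
  (forall x y z, nth 0 (F x y z) H = vH) -> (forall x y z, nth 0 (F x y z) b = y) ->
  (forall x y z, nth 0 (F x y z) 19 = z) -> (forall x y z, nth 0 (F x y z) 22 = 0) ->
  (forall x y z v, set_nth 0 (F x y z) N v = F v y z) ->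
  (forall x y z v, set_nth 0 (F x y z) b v = F x v z) ->
  (forall x y z v, set_nth 0 (F x y z) 19 v = F x y v) ->
  vN < vH -> 2 * vH <= M ->
  run M (shift N H b) 10 (F vN vb 0, w, o) (F ((2 * vN) %% vH) ((2 * vN) %/ vH) 0, w, o).
Proof.
move=> N19 F0 FN FH Fb F19 F22 setN setb set19 ltH leM.
pose d := (2 * vN) %/ vH.
have dE : 1 - (vH - (vN + vN)) = d.
  rewrite /d; case: (ltnP (2 * vN) vH) => h; first by rewrite divn_small //; lia.
  have -> : 2 * vN = 1 * vH + (2 * vN - vH) by lia.
  by rewrite divnMDl ?divn_small; lia.
apply: (run_seq (T1 := 4) (T2 := 6) (s2 := (F (2 * vN) d d, w, o))) => //.
  apply: run_block_eq => //=.
    by rewrite !(setN, setb, set19, F0, FN, FH, Fb, F19, F22) dE; apply/and3P; split=> //; lia.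
  by rewrite !(setN, setb, set19, F0, FN, FH, Fb, F19, F22) dE addn0 addnn -mul2n.
have d1 : d <= 1 by rewrite -dE leq_subr.
pose S j q : state := (F (2 * vN - j * vH) d q, w, o).
have modE : 2 * vN - d * vH = (2 * vN) %% vH.
  by rewrite {1}(divn_eq (2 * vN) vH) addKn.
have -> : (F (2 * vN) d d, w, o) = S 0 d by rewrite /S mul0n subn0.
rewrite -/d -modE -/(S d 0); apply: run_weaken; last apply: (run_loop (T := 1)) => //.
- by lia.
- by move=> j q; rewrite /= F0.
- by move=> j q; rewrite /= F19.
- by move=> j q; rewrite /= F19 F0 set19 subn1.
- move=> j q _; apply: run_block_eq => //=; rewrite FN FH setN /S mulSn.
  by congr (F _ _ _, _, _); lia.
Qed.

Lemma run_mulX M a (F : nat -> nat -> seq nat) v B w o :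
  (forall x z, nth 0 (F x z) 0 = 1) -> (forall x z, nth 0 (F x z) 2 = B) ->
  (forall x z, nth 0 (F x z) a = x) -> (forall x z, nth 0 (F x z) 21 = z) ->
  (forall x z, nth 0 (F x z) 22 = 0) ->
  (forall x z y, set_nth 0 (F x z) a y = F y z) ->
  (forall x z y, set_nth 0 (F x z) 21 y = F x y) ->
  B <= M -> v * 2 ^ B <= M ->
  run M (mulX a) (B * 4 + 3) (F v 0, w, o) (F (v * 2 ^ B) 0, w, o).
Proof.
move=> F0 F2 Fa F21 F22 seta set21 leB leM.
apply: (run_seq (T1 := 1) (T2 := B * 4 + 2) (s2 := (F v B, w, o))); last by lia.
  by apply: run_block_eq; rewrite //= F2 F22 addn0 ?set21 ?andbT.
pose S j q : state := (F (v * 2 ^ j) q, w, o).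
have -> : (F v B, w, o) = S 0 B by rewrite /S muln1.
rewrite -/(S B 0); apply: (run_loop (T := 1)) => //.
- by move=> j q; rewrite /= F0.
- by move=> j q; rewrite /= F21.
- by move=> j q; rewrite /= F21 F0 set21 subn1.
move=> j q jq.
have dbl : v * 2 ^ j + v * 2 ^ j = v * 2 ^ j.+1 by rewrite expnS; lia.
apply: run_block_eq => //=; rewrite Fa dbl ?seta // andbT.
by apply: leq_trans leM; rewrite leq_mul2l leq_pexp2l ?orbT //; lia.
Qed.

(* Register 22 is never written and serves as the constant 0.  E is the packed
   matrix, HE = 2^(n*n), HN = 2^n, c the word of the current S2, W the running
   sum, P the product over the rows treated so far, A and Q its multiples for a
   row vertex inside and outside S; TE and TC are the copies of E and c being
   shifted out, and the k's are loop counters.  While printing, HE holds X^(m+1)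
   and P the current digit. *)
Definition regs n E HE HN m W c k9 P k11 A Q TE TC k16 e s t u k21 : seq nat :=
  [:: 1; n; n + n + 1; E; HE; HN; m; W; c; k9; P; k11; A; Q; TE; TC; k16; e; s; t; u; k21].

(** Registers 19 and 20 receive bits telling whether the entry is an edge to a vertex of [S2], or an
    edge to one outside it; the loops on them are conditional multiplications. *)
Definition cell_code : cmd :=
  Seq (shift 14 4 17) (Seq (shift 15 5 18)
  (Seq (Block [:: IAdd 19 17 18; ISub 19 19 0; ISub 20 17 18])
  (Seq (Loop 19 (mulX 12)) (Seq (Loop 20 (mulX 13))
  (Block [:: IConst 17 0; IConst 18 0]))))).

(** Scratch registers are reset to 0 at the end, so that the invariant of the enclosing loop need
    not track them. *)
Definition row_code : cmd :=
  Seq (Block [:: IAdd 12 10 22; IAdd 13 10 22; IAdd 15 8 22; IAdd 16 1 22])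
  (Seq (Loop 16 cell_code)
  (Block [:: IAdd 10 12 13; IConst 12 0; IConst 13 0; IConst 15 0])).

Definition subset_code : cmd :=
  Seq (Block [:: IConst 10 1; IAdd 14 3 22; IAdd 11 1 22])
  (Seq (Loop 11 row_code)
  (Block [:: IAdd 7 7 10; IAdd 8 8 0; IConst 10 0; IConst 14 0])).

Definition sum_code : cmd :=
  Seq (Block [:: IAdd 9 5 22]) (Seq (Loop 9 subset_code) (Block [:: IConst 8 0])).

(** The number of edges is not part of the input; it is obtained in register 6 as the sum of the
    matrix entries. *)
Definition read_code : cmd :=
  Seq (Block [:: IConst 0 1; IRead 1; IAdd 2 1 1; IAdd 2 2 0; IConst 4 1; IConst 5 1; IAdd 9 1 22])
  (Seq (Loop 9 (Block [:: IAdd 5 5 5]))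
  (Seq (Block [:: IAdd 9 1 22])
  (Loop 9 (Seq (Block [:: IAdd 11 1 22])
    (Loop 11 (Block [:: IRead 17; IAdd 3 3 3; IAdd 3 3 17; IAdd 4 4 4; IAdd 6 6 17; IConst 17 0])))))).

(** With [X^(m+1)] in register 4, the [2n + 1] bits shifted out of the sum form its leading base-[X]
    digit. *)
Definition digit_code : cmd :=
  Seq (Block [:: IAdd 21 2 22])
  (Seq (Loop 21 (Seq (shift 7 4 17) (Block [:: IAdd 10 10 10; IAdd 10 10 17; IConst 17 0])))
  (Block [:: IPrint 10; IConst 10 0])).

Definition print_code : cmd :=
  Seq (Block [:: IConst 4 1; IAdd 9 6 0])
  (Seq (Loop 9 (mulX 4))
  (Seq (Block [:: IAdd 9 6 0])
  (Loop 9 digit_code))).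

(* Bit j of the K-bit word v, bit 0 being the most significant one. *)
Definition top_bit (K v j : nat) : nat := 2 * (v * 2 ^ j %% 2 ^ K) %/ 2 ^ K.

Lemma top_bit_le1 K v j : top_bit K v j <= 1.
Proof.
rewrite /top_bit -ltnS ltn_divLR ?expn_gt0 // ltn_pmul2l //.
by rewrite ltn_mod expn_gt0.
Qed.

(* One more bit than the 2n bits of the number of vertex sets, so that every
   cut count is a single digit. *)
Definition base n := 2 ^ (n + n + 1).
Definition adj_bit n E i y := top_bit (n * n) E (i * n + y).
(** On bits, the truncated [e + s - 1] is the conjunction of [e] and [s], and [e - s] is [e] without
    [s]. The upper limits [j], [i] and [c] here and below turn these quantities into loop
    invariants. *)
Definition uncut_in n E c i j := \sum_(y < j) (adj_bit n E i y + top_bit n c y - 1).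
Definition uncut_out n E c i j := \sum_(y < j) (adj_bit n E i y - top_bit n c y).
Definition row_factor n E c i := base n ^ uncut_in n E c i n + base n ^ uncut_out n E c i n.
Definition row_prod n E c i := \prod_(x < i) row_factor n E c x.
Definition weight_sum n E c := \sum_(c' < c) row_prod n E c' n.
(** A generous cubic exponent that covers the row products, the running sum, twice [X^(m+1)] and all
    counters. *)
Definition maxval n := 2 ^ ((2 * n + 2) * (n + 1) ^ 2 + 2).

(** * Bounds on the intermediate values *)

Lemma base_gt0 n : 0 < base n.
Proof. by rewrite expn_gt0. Qed.

Lemma sum_le1 (F : nat -> nat) j : (forall y, F y <= 1) -> \sum_(y < j) F y <= j.
Proof.
move=> leF; rewrite -[X in _ <= X]card_ord -sum1_card.
exact: leq_sum.
Qed.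

Lemma uncut_in_le n E c i j : uncut_in n E c i j <= j.
Proof.
apply: (@sum_le1 (fun y => adj_bit n E i y + top_bit n c y - 1)) => y.
by have := top_bit_le1 (n * n) E (i * n + y); have := top_bit_le1 n c y; rewrite /adj_bit; lia.
Qed.

Lemma uncut_out_le n E c i j : uncut_out n E c i j <= j.
Proof.
apply: (@sum_le1 (fun y => adj_bit n E i y - top_bit n c y)) => y.
by have := top_bit_le1 (n * n) E (i * n + y); rewrite /adj_bit; lia.
Qed.

Lemma row_factor_le n E c i : row_factor n E c i <= 2 * base n ^ n.
Proof.
by rewrite mul2n -addnn leq_add // leq_pexp2l ?base_gt0 ?uncut_in_le ?uncut_out_le.
Qed.

Lemma row_prod_le n E c i : row_prod n E c i <= (2 * base n ^ n) ^ i.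
Proof.
elim: i => [|i IH]; rewrite /row_prod ?big_ord0 // big_ord_recr /= expnSr.
by apply: leq_mul => //; apply: row_factor_le.
Qed.

Lemma weight_sum_le n E c : weight_sum n E c <= c * (2 * base n ^ n) ^ n.
Proof.
elim: c => [|c IH]; rewrite /weight_sum ?big_ord0 // big_ord_recr /= mulSn addnC.
by apply: leq_add => //; apply: row_prod_le.
Qed.

Lemma exp_le_maxval n k : k <= (2 * n + 2) * (n + 1) ^ 2 + 2 -> 2 ^ k <= maxval n.
Proof. by move=> lek; rewrite leq_pexp2l. Qed.

(** The factor 2 leaves room for adding the two multiples of [P] at the end of a row. *)
Lemma row_value_le_maxval n i j : i < n -> j <= n ->
  2 * ((2 * base n ^ n) ^ i * base n ^ j) <= maxval n.
Proof.
move=> ltin lejn.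
rewrite /base -!expnM -expnS -expnM -expnD -expnS; apply: exp_le_maxval.
apply: (@leq_trans (((n + n + 1) * n).+1 * n + (n + n + 1) * n).+1); last by nia.
by rewrite ltnS leq_add // leq_mul // ltnW.
Qed.

Lemma weight_sum_bound_le_maxval n c : c <= 2 ^ n -> c * (2 * base n ^ n) ^ n <= maxval n.
Proof.
move=> lec; apply: (@leq_trans (2 ^ n * (2 * base n ^ n) ^ n)).
  by rewrite leq_mul2r lec orbT.
rewrite /base -!expnM -expnS -expnM -expnD; apply: exp_le_maxval; nia.
Qed.

Lemma num_le_maxval n k : k <= (2 * n + 2) * (n + 1) ^ 2 + 2 -> k <= maxval n.
Proof. by move=> lek; apply: leq_trans (exp_le_maxval lek); apply/ltnW/ltn_expl. Qed.

(** Reduces the side conditions on counters and packed words to a quadratic bound, within reach of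
    [lia]. *)
Lemma quadratic_le n k : k <= n * n + 2 * n + 2 -> k <= (2 * n + 2) * (n + 1) ^ 2 + 2.
Proof. by move=> lek; apply: leq_trans lek _; nia. Qed.

(** * Execution of the program *)

(** Two shifts at 10, blocks of 3 and 2 instructions, and two conditional multiplications at
    [4 * (n + n + 1) + 8]. *)
Definition cell_time n := 8 * (n + n + 1) + 41.

Lemma run_cell n E m W c k9 P k11 i j q w o :
  i < n -> j < n -> P <= (2 * base n ^ n) ^ i ->
  let S j := regs n E (2 ^ (n * n)) (2 ^ n) m W c k9 P k11
    (P * base n ^ uncut_in n E c i j) (P * base n ^ uncut_out n E c i j)
    (E * 2 ^ (i * n + j) %% 2 ^ (n * n)) (c * 2 ^ j %% 2 ^ n) q 0 0 0 0 0 in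
  run (maxval n) cell_code (cell_time n) (S j, w, o) (S j.+1, w, o).
Proof.
move=> ltin ltjn leP S; rewrite /S {S}.
set A := P * _; set Q := P * _; set TE := _ %% _; set TC := _ %% _.
set A' := P * _; set Q' := P * _; set TE' := _ %% _; set TC' := _ %% _.
have TE_lt : TE < 2 ^ (n * n) by rewrite ltn_mod expn_gt0.
have TC_lt : TC < 2 ^ n by rewrite ltn_mod expn_gt0.
have TE'E : TE' = 2 * TE %% 2 ^ (n * n).
  by rewrite /TE' /TE modnMmr addnS expnS mulnCA.
have TC'E : TC' = 2 * TC %% 2 ^ n by rewrite /TC' /TC modnMmr expnS mulnCA.
have le_base x : x <= n -> P * base n ^ x <= maxval n.
  move=> lex; apply: leq_trans (row_value_le_maxval ltin lex).
  by apply: leq_trans (leq_pmull _ _) => //; rewrite leq_mul2r leP orbT.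
pose R A Q TE TC e s t u := regs n E (2 ^ (n * n)) (2 ^ n) m W c k9 P k11
  A Q TE TC q e s t u.
pose e := adj_bit n E i j; pose s := top_bit n c j.
have e1 : e <= 1 by apply: top_bit_le1.
have s1 : s <= 1 by apply: top_bit_le1.
pose t := e + s - 1; pose u := e - s.
have es2 : e + s <= 2 := leq_add e1 s1.
have t1 : t <= 1 by rewrite leq_subLR.
have u1 : u <= 1 by apply: leq_trans (leq_subr _ _) e1.
have sameS : uncut_in n E c i j.+1 = uncut_in n E c i j + t by rewrite /uncut_in big_ord_recr.
have diffS : uncut_out n E c i j.+1 = uncut_out n E c i j + u by rewrite /uncut_out big_ord_recr.
have leB : n + n + 1 <= maxval n by apply/num_le_maxval/quadratic_le; clear; lia.
apply: (run_seq (T1 := 10) (T2 := cell_time n - 10) (s2 := (R A Q TE' TC e 0 0 0 0, w, o))).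
- rewrite TE'E.
  apply: (run_shift (F := fun x y z => R A Q x TC y 0 z 0 0)) => //.
  by rewrite -expnS; apply/exp_le_maxval/quadratic_le; clear; lia.
- apply: (run_seq (T1 := 10) (T2 := cell_time n - 20) (s2 := (R A Q TE' TC' e s 0 0 0, w, o))).
  + rewrite TC'E.
    apply: (run_shift (F := fun x y z => R A Q TE' x e y z 0 0)) => //.
    by rewrite -expnS; apply/exp_le_maxval/quadratic_le; clear; lia.
  + apply: (run_seq (T1 := 3) (T2 := cell_time n - 23) (s2 := (R A Q TE' TC' e s t u 0, w, o))).
    * apply: run_block_eq => //=; rewrite andbT.
      by apply/num_le_maxval/quadratic_le/(leq_trans es2); clear; lia.
    * apply: (run_seq (T1 := 4 * (n + n + 1) + 8) (T2 := 4 * (n + n + 1) + 10) (s2 := (R A' Q TE' TC' e s 0 u 0, w, o))).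
      - rewrite /A' sameS expnD mulnA -/A.
        (* [j] multiplications done, [q] left; as [t <= 1], the loop runs at most once. *)
        pose S j q : state := (R (A * base n ^ j) Q TE' TC' e s q u 0, w, o).
        have -> : (R A Q TE' TC' e s t u 0, w, o) = S 0 t by rewrite /S muln1.
        rewrite -/(S t 0); apply: run_weaken; last apply: (run_loop (T := (n + n + 1) * 4 + 3)) => //.
          by rewrite (leq_trans (leq_add (leq_mul t1 (leqnn _)) (leqnn _))) //; clear; lia.
        by move=> j' q'; rewrite /S /= subn1.
        move=> j' q' jq; rewrite /S expnSr mulnA.
        apply: (run_mulX (F := fun x z => R x Q TE' TC' e s q'.+1 u z) (B := n + n + 1)) => //.
        (* The exponent reached never exceeds the one after column [j], which is at most [n]. *)
        rewrite -mulnA -expnSr -mulnA -expnD; apply: le_base.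
        apply: leq_trans (_ : uncut_in n E c i j.+1 <= _).
          by rewrite sameS leq_add2l -jq addnS ltnS leq_addr.
        by apply: leq_trans (uncut_in_le _ _ _ _ _) _.
      - apply: (run_seq (T1 := 4 * (n + n + 1) + 8) (T2 := 2) (s2 := (R A' Q' TE' TC' e s 0 0 0, w, o))).
        + rewrite /Q' diffS expnD mulnA -/Q.
          pose S j q : state := (R A' (Q * base n ^ j) TE' TC' e s 0 q 0, w, o).
          have -> : (R A' Q TE' TC' e s 0 u 0, w, o) = S 0 u by rewrite /S muln1.
          rewrite -/(S u 0); apply: run_weaken; last apply: (run_loop (T := (n + n + 1) * 4 + 3)) => //.
            by rewrite (leq_trans (leq_add (leq_mul u1 (leqnn _)) (leqnn _))) //; clear; lia.
          by move=> j' q'; rewrite /S /= subn1.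
          move=> j' q' jq; rewrite /S expnSr mulnA.
          apply: (run_mulX (F := fun x z => R A' x TE' TC' e s 0 q'.+1 z) (B := n + n + 1)) => //.
          rewrite -mulnA -expnSr -mulnA -expnD; apply: le_base.
          apply: leq_trans (_ : uncut_out n E c i j.+1 <= _).
            by rewrite diffS leq_add2l -jq addnS ltnS leq_addr.
          by apply: leq_trans (uncut_out_le _ _ _ _ _) _.
        + exact: run_block_eq.
        + by lia.
      - by rewrite /cell_time; clear; lia.
    * by rewrite /cell_time; clear; lia.
  + by rewrite /cell_time; clear; lia.
- by rewrite /cell_time; clear; lia.
Qed.

Definition row_time n := n * (cell_time n + 3) + 10.

(** The shifted matrix carries over from row to row, since [n] cells move it from bit [i * n] to bit
    [i.+1 * n]; the subset word is copied afresh for each row. *)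
Lemma run_row n E m W c k9 k11 i w o :
  i < n -> c < 2 ^ n ->
  let S i := regs n E (2 ^ (n * n)) (2 ^ n) m W c k9 (row_prod n E c i) k11
    0 0 (E * 2 ^ (i * n) %% 2 ^ (n * n)) 0 0 0 0 0 0 0 in
  run (maxval n) row_code (row_time n) (S i, w, o) (S i.+1, w, o).
Proof.
move=> ltin ltc S; rewrite /S {S}.
set P := row_prod n E c i.
have leP : P <= (2 * base n ^ n) ^ i by apply: row_prod_le.
pose S j q : state := (regs n E (2 ^ (n * n)) (2 ^ n) m W c k9 P k11
  (P * base n ^ uncut_in n E c i j) (P * base n ^ uncut_out n E c i j)
  (E * 2 ^ (i * n + j) %% 2 ^ (n * n)) (c * 2 ^ j %% 2 ^ n) q 0 0 0 0 0, w, o).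
have leM x : x <= (2 * base n ^ n) ^ i * base n ^ n -> 2 * x <= maxval n.
  move=> lex; apply: leq_trans (row_value_le_maxval ltin (leqnn n)).
  by rewrite leq_mul2l lex.
have leP2 : 2 * P <= maxval n.
  by apply/leM/(leq_trans leP); rewrite leq_pmulr // expn_gt0 base_gt0.
have lecM : c <= maxval n.
  by apply: ltnW (leq_trans ltc _); apply/exp_le_maxval/quadratic_le; clear; lia.
apply: (run_seq (T1 := 4) (T2 := n * (cell_time n + 3) + 6) (s2 := S 0 n)).
- apply: run_block_eq => //=.
    rewrite !addn0 lecM (num_le_maxval (n := n) (k := n)) ?andbT ?andbb; last by apply: quadratic_le; clear; lia.
    by apply: leq_trans leP2; rewrite leq_pmull.
  by rewrite !addn0 /S /uncut_in /uncut_out !big_ord0 !muln1 addn0 (modn_small ltc).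
- apply: (run_seq (T1 := n * (cell_time n + 3) + 2) (T2 := 4) (s2 := S n 0)).
  + apply: run_loop => // j q.
      by rewrite /S /= subn1.
    by move=> jq; apply: run_cell => //; lia.
  + apply: run_block_eq => //=.
      rewrite andbT; apply: leq_trans (leM (P * base n ^ n) _).
        by rewrite mul2n -addnn leq_add // leq_mul2l leq_pexp2l ?base_gt0 ?uncut_in_le ?uncut_out_le ?orbT.
      by rewrite leq_mul2r leP orbT.
    (* [A + Q] is [P] times the row factor, hence the next partial product. *)
    by rewrite -mulnDr -/(row_factor n E c i) {1}/row_prod big_ord_recr /= -/(row_prod n E c i) mulSnr.
  + by lia.
- by rewrite /row_time; lia.
Qed.

Definition subset_time n := n * (row_time n + 3) + 9.

Lemma run_subset n E m c k9 w o :
  c < 2 ^ n -> E < 2 ^ (n * n) ->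
  let S c := regs n E (2 ^ (n * n)) (2 ^ n) m (weight_sum n E c) c k9 0 0
    0 0 0 0 0 0 0 0 0 0 in
  run (maxval n) subset_code (subset_time n) (S c, w, o) (S c.+1, w, o).
Proof.
move=> ltc ltE S; rewrite /S {S}.
pose S j q : state := (regs n E (2 ^ (n * n)) (2 ^ n) m (weight_sum n E c) c k9
  (row_prod n E c j) q 0 0 (E * 2 ^ (j * n) %% 2 ^ (n * n)) 0 0 0 0 0 0 0, w, o).
have lecM : c + 1 <= maxval n.
  by rewrite addn1; apply: leq_trans ltc _; apply/exp_le_maxval/quadratic_le; clear; lia.
apply: (run_seq (T1 := 3) (T2 := n * (row_time n + 3) + 6) (s2 := S 0 n)).
- apply: run_block_eq => //=.
    rewrite !addn0 (num_le_maxval (n := n) (k := n)) ?andbT; last by apply: quadratic_le; clear; lia.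
    rewrite expn_gt0 /=; apply: leq_trans (ltnW ltE) _.
    by apply/exp_le_maxval/quadratic_le; clear; lia.
  (* Since [E < 2 ^ (n * n)], the fresh copy of [E] is the residue expected at row 0. *)
  by rewrite /S /row_prod big_ord0 mul0n muln1 !addn0 (modn_small ltE).
- apply: (run_seq (T1 := n * (row_time n + 3) + 2) (T2 := 4) (s2 := S n 0)).
  + apply: run_loop => // j q.
      by rewrite /S /= subn1.
    by move=> jq; apply: run_row => //; lia.
  + have totS : weight_sum n E c + row_prod n E c n = weight_sum n E c.+1.
      by rewrite /weight_sum big_ord_recr.
    apply: run_block_eq => //=.
      rewrite totS lecM ?andbT; apply: leq_trans (weight_sum_le _ _ _) _.
      exact: weight_sum_bound_le_maxval.
    by rewrite totS (addn1 c).
  + by lia.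
- by rewrite /subset_time; lia.
Qed.

Definition sum_time n := 2 ^ n * (subset_time n + 3) + 4.

Lemma run_sum n E m w o : E < 2 ^ (n * n) ->
  let S W := regs n E (2 ^ (n * n)) (2 ^ n) m W 0 0 0 0 0 0 0 0 0 0 0 0 0 0 in
  run (maxval n) sum_code (sum_time n) (S 0, w, o) (S (weight_sum n E (2 ^ n)), w, o).
Proof.
move=> ltE S; rewrite /S {S}.
pose S j q : state := (regs n E (2 ^ (n * n)) (2 ^ n) m (weight_sum n E j) j q 0 0
  0 0 0 0 0 0 0 0 0 0, w, o).
apply: (run_seq (T1 := 1) (T2 := 2 ^ n * (subset_time n + 3) + 3) (s2 := S 0 (2 ^ n))).
- apply: run_block_eq => //=.
    by rewrite addn0 andbT; apply/exp_le_maxval/quadratic_le; clear; lia.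
  by rewrite /S /weight_sum big_ord0 addn0.
- apply: (run_seq (T1 := 2 ^ n * (subset_time n + 3) + 2) (T2 := 1) (s2 := S (2 ^ n) 0)).
  + apply: run_loop => // j q.
      by rewrite /S /= subn1.
    by move=> jq; apply: run_subset => //; lia.
  + exact: run_block_eq.
  + by lia.
- by rewrite /sum_time; lia.
Qed.

(** Horner's rule in base 2, most significant bit first, in the form in which [read_code]
    accumulates register 3. *)
Definition packed (L : seq nat) : nat := foldl (fun a b => a + a + b) 0 L.

Lemma packed_rcons L b : packed (rcons L b) = packed L + packed L + b.
Proof. by rewrite /packed foldl_rcons. Qed.

Lemma packed_lt L : all (fun b => b <= 1) L -> packed L < 2 ^ size L.
Proof.
elim/last_ind: L => [//|L b IH]; rewrite all_rcons => /andP[b1 /IH].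
by rewrite packed_rcons size_rcons expnS; lia.
Qed.

Lemma sumn_bits_le L : all (fun b => b <= 1) L -> sumn L <= size L.
Proof. by elim: L => //= b L IH /andP[b1 /IH]; lia. Qed.

Definition read_time n := n * 4 + n * (n * 9 + 6) + 12.

Lemma run_read n L o : size L = n * n -> all (fun b => b <= 1) L ->
  run (maxval n) read_code (read_time n) (nseq 22 0, n :: L, o)
   (regs n (packed L) (2 ^ (n * n)) (2 ^ n) (sumn L) 0 0 0 0 0 0 0 0 0 0 0 0 0 0 0, [::], o).
Proof.
move=> sizeL bitL.
pose S0 j q : state := (regs n 0 1 (2 ^ j) 0 0 0 q 0 0 0 0 0 0 0 0 0 0 0 0, L, o).
pose S i j q q' : state := (regs n (packed (take (i * n + j) L)) (2 ^ (i * n + j)) (2 ^ n)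
  (sumn (take (i * n + j) L)) 0 0 q 0 q' 0 0 0 0 0 0 0 0 0 0, drop (i * n + j) L, o).
have leM1 : 1 <= maxval n by rewrite expn_gt0.
have leMn k : k <= 2 * n + 1 -> k <= maxval n by move=> lek; apply/num_le_maxval/quadratic_le; clear -lek; lia.
apply: (run_seq (T1 := 7) (T2 := n * 4 + n * (n * 9 + 6) + 5) (s2 := S0 0 n)).
- apply: run_block_eq => //=.
    by rewrite leM1 !leMn //; lia.
  by rewrite addn0.
- apply: (run_seq (T1 := n * 4 + 2) (T2 := n * (n * 9 + 6) + 3) (s2 := S0 n 0)).
  + apply: (run_loop (T := 1)) => // j q.
      by rewrite /S0 /= subn1.
    move=> jq; have dbl : 2 ^ j + 2 ^ j = 2 ^ j.+1 by rewrite expnS; lia.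
    apply: run_block_eq => //=; rewrite dbl //= andbT.
    by apply/exp_le_maxval/quadratic_le; clear -jq; lia.
  + apply: (run_seq (T1 := 1) (T2 := n * (n * 9 + 6) + 2) (s2 := S 0 0 n 0)).
    * apply: run_block_eq => //=; rewrite addn0.
        by rewrite leMn //; lia.
      by rewrite /S take0 drop0.
    * have -> : (regs n (packed L) (2 ^ (n * n)) (2 ^ n) (sumn L) 0 0 0 0 0 0 0 0 0 0 0 0 0 0 0, [::], o) = S n 0 0 0.
        by rewrite /S addn0 -sizeL take_size drop_size.
      apply: run_weaken; last apply: (run_loop (T := n * 9 + 3) (S := fun j q => S j 0 q 0)) => //; [by clear; lia|move=> i q|move=> i q].
        by rewrite /S /= subn1.
      move=> iq.
      apply: (run_seq (T1 := 1) (T2 := n * 9 + 2) (s2 := S i 0 q.+1 n)).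
      - by apply: run_block_eq => //=; rewrite (addn0 n) ?leMn //; clear; lia.
      (* Position 0 of the next row is position [n] of the current one. *)
      - have -> : S i.+1 0 q.+1 0 = S i n q.+1 0.
          by rewrite /S mulSnr addn0.
        apply: (run_loop (T := 6) (S := fun j q' => S i j q.+1 q')) => // j q'.
          by rewrite /S /= subn1.
        move=> jq.
        have lt : i * n + j < size L by rewrite sizeL; clear -iq jq; nia.
        have b1 : nth 0 L (i * n + j) <= 1 by apply: (allP bitL); apply: mem_nth.
        have sz : size (take (i * n + j) L) = i * n + j by rewrite size_takel // ltnW.
        have bt : all (fun b => b <= 1) (take (i * n + j) L).
          by apply/allP => b /mem_take; apply: (allP bitL).
        rewrite /S addnS (take_nth 0 lt) packed_rcons -cats1 sumn_cat /= addn0 expnS.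
        move: (packed_lt bt) (sumn_bits_le bt); rewrite sz => bvlt sle.
        have := @exp_le_maxval n (i * n + j).+1; rewrite (expnS 2 (i * n + j)) => leM2.
        have /leM2 {}leM2 : (i * n + j).+1 <= (2 * n + 2) * (n + 1) ^ 2 + 2.
          by apply: quadratic_le; clear -lt sizeL; lia.
        have leM3 : i * n + j + 1 <= maxval n by apply/num_le_maxval/quadratic_le; clear -lt sizeL; lia.
        rewrite (drop_nth 0 lt).
        apply: run_block_eq => //=.
          by rewrite ?andbT; apply/and5P; split; clear -b1 bvlt sle leM2 leM3; lia.
        by rewrite mul2n -addnn.
      - by lia.
    * by lia.
  + by lia.
- by rewrite /read_time; lia.
Qed.

(** Digit [k] from the top of an [m.+1]-digit number: reduction modulo [X^(m+1)] drops the [k]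
    leading digits, and one more factor [X] pushes out the next. *)
Definition digit n m W k := W * base n ^ k %% base n ^ m.+1 * base n %/ base n ^ m.+1.

Definition digit_time n := (n + n + 1) * 16 + 5.

(** After [j] doublings, registers 7 and 10 hold the remainder and the quotient of [W * 2 ^ j] by
    [X^(m+1)]. *)
Lemma run_digit n E HN m W k9 w o :
  m <= n * n -> W < base n ^ m.+1 ->
  let S W o : state := (regs n E (base n ^ m.+1) HN m W 0 k9 0 0 0 0 0 0 0 0 0 0 0 0, w, o) in
  run (maxval n) digit_code (digit_time n) (S W o)
    (S (W * base n %% base n ^ m.+1) (rcons o (W * base n %/ base n ^ m.+1))).
Proof.
move=> lem ltW S; rewrite /S {S}.
set H := base n ^ m.+1.
have H_gt0 : 0 < H by rewrite expn_gt0 base_gt0.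
have leH : 2 * H <= maxval n.
  by rewrite /H /base -expnM -expnS; apply: exp_le_maxval; clear -lem; nia.
pose S j q : state := (regs n E H HN m (W * 2 ^ j %% H) 0 k9 (W * 2 ^ j %/ H) 0
  0 0 0 0 0 0 0 0 0 q, w, o).
apply: (run_seq (T1 := 1) (T2 := (n + n + 1) * 16 + 4) (s2 := S 0 (n + n + 1))).
- apply: run_block_eq => //=.
    by rewrite addn0 andbT; apply/num_le_maxval/quadratic_le; clear; lia.
  by rewrite /S muln1 addn0 (divn_small ltW) (modn_small ltW).
- apply: (run_seq (T1 := (n + n + 1) * 16 + 2) (T2 := 2) (s2 := S (n + n + 1) 0)).
  + apply: (run_loop (T := 13)) => // j q.
      by rewrite /S /= subn1.
    move=> jq.
    set V := W * 2 ^ j; pose b := 2 * (V %% H) %/ H.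
    have V2 : W * 2 ^ j.+1 = 2 * V by rewrite expnS mulnCA.
    have modE : W * 2 ^ j.+1 %% H = 2 * (V %% H) %% H by rewrite V2 modnMmr.
    have divE : W * 2 ^ j.+1 %/ H = V %/ H + V %/ H + b.
      rewrite V2 {1}(divn_eq V H) mulnDr mulnA divnMDl // /b.
      by rewrite mul2n addnn.
    (* The partial digit stays below [X], as [W < H] and at most [2n + 1] doublings occur. *)
    have ltd : W * 2 ^ j.+1 %/ H < base n.
      rewrite ltn_divLR // mulnC; apply: leq_trans (_ : W.+1 * 2 ^ j.+1 <= _).
        by rewrite mulnC ltn_pmul2r ?expn_gt0.
      rewrite mulnC; apply: leq_mul => //.
      by rewrite leq_pexp2l //; lia.
    have leb : base n <= maxval n by apply/exp_le_maxval/quadratic_le; clear; lia.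
    apply: (run_seq (T1 := 10) (T2 := 3) (s2 := (regs n E H HN m (W * 2 ^ j.+1 %% H) 0 k9
        (V %/ H) 0 0 0 0 0 0 b 0 0 0 q.+1, w, o))) => //.
      rewrite modE.
      apply: (run_shift (F := fun x y z => regs n E H HN m x 0 k9 (V %/ H) 0 0 0 0 0 0 y 0 z 0 q.+1)) => //.
      by rewrite ltn_mod.
    rewrite /S divE; apply: run_block_eq => //=.
    by rewrite divE in ltd; apply/and3P; split=> //; lia.
  + exact: run_block_eq.
  + by lia.
- by rewrite /digit_time; lia.
Qed.

Definition print_time n :=
  (n * n + 1) * ((n + n + 1) * 4 + 6 + (digit_time n + 3)) + 7.

Lemma run_print n E HE HN m W w :
  m <= n * n -> W < base n ^ m.+1 ->
  run (maxval n) print_code (print_time n)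
    (regs n E HE HN m W 0 0 0 0 0 0 0 0 0 0 0 0 0 0, w, [::])
    (regs n E (base n ^ m.+1) HN m (W * base n ^ m.+1 %% base n ^ m.+1) 0 0 0 0 0 0 0 0 0 0 0 0 0 0, w,
      [seq digit n m W k | k <- iota 0 m.+1]).
Proof.
move=> lem ltW; set H := base n ^ m.+1.
pose S0 j q : state := (regs n E (base n ^ j) HN m W 0 q 0 0 0 0 0 0 0 0 0 0 0 0, w, [::]).
pose S j q : state := (regs n E H HN m (W * base n ^ j %% H) 0 q 0 0 0 0 0 0 0 0 0 0 0 0, w,
  [seq digit n m W k | k <- iota 0 j]).
have lemM : m + 1 <= maxval n by apply/num_le_maxval/quadratic_le; clear -lem; lia.
have leM1 : 1 <= maxval n by rewrite expn_gt0.
pose T1 := m.+1 * ((n + n + 1) * 4 + 3 + 3) + 2; pose T2 := m.+1 * (digit_time n + 3) + 2.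
apply: (run_seq (T1 := 2) (T2 := T1 + (1 + T2)) (s2 := S0 0 m.+1)).
- by apply: run_block_eq; rewrite //= ?leM1 ?lemM // (addn1 m).
- apply: (run_seq (T1 := T1) (T2 := 1 + T2) (s2 := S0 m.+1 0)) => //.
  + apply: run_loop => // j q.
      by rewrite /S0 /= subn1.
    move=> jq; rewrite /S0 expnSr.
    apply: (run_mulX (F := fun x z => regs n E x HN m W 0 q.+1 0 0 0 0 0 0 0 0 0 0 0 z) (B := n + n + 1)) => //.
      by apply/num_le_maxval/quadratic_le; clear; lia.
    rewrite -/(base n) -expnSr /base -expnM; apply: exp_le_maxval.
    apply: (@leq_trans ((n + n + 1) * m.+1)); first by rewrite leq_mul2l; lia.
    by clear -lem; nia.
  + apply: (run_seq (T1 := 1) (T2 := T2) (s2 := S 0 m.+1)) => //.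
    * by apply: run_block_eq; rewrite //= ?lemM // (addn1 m) /S muln1 modn_small.
    * rewrite -/(S m.+1 0); apply: run_loop => // j q.
        by rewrite /S /= subn1.
      move=> jq; rewrite /S -{2}(addn1 j) iotaD map_cat /= cats1 add0n.
      have -> : W * base n ^ j.+1 %% H = W * base n ^ j %% H * base n %% H.
        by rewrite modnMml expnSr mulnA.
      by apply: run_digit => //; rewrite ltn_mod expn_gt0 base_gt0.
- rewrite /T1 /T2 /print_time.
  have := leq_mul (_ : m.+1 <= n * n + 1) (leqnn ((n + n + 1) * 4 + 6 + (digit_time n + 3))).
  by lia.
Qed.

(** * Packed words, digits and cuts *)

Lemma packed_cat L1 L2 : packed (L1 ++ L2) = packed L1 * 2 ^ size L2 + packed L2.
Proof.
elim/last_ind: L2 => [|L2 b IH]; first by rewrite cats0 muln1 addn0.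
by rewrite -rcons_cat !packed_rcons size_rcons expnS IH; lia.
Qed.

(** Split the word at position [j]: the reduction removes the prefix, and the division removes the
    suffix, which is too small to carry. *)
Lemma top_bit_packed L j : all (fun b => b <= 1) L -> j < size L ->
  top_bit (size L) (packed L) j = nth 0 L j.
Proof.
move=> bitL ltj; rewrite /top_bit.
have defL : L = take j L ++ (nth 0 L j :: drop j.+1 L).
  by rewrite -drop_nth // cat_take_drop.
set T := take j L in defL; set b := nth 0 L j in defL *; set D := drop j.+1 L in defL.
have bitD : all (fun b => b <= 1) D.
  by apply/allP => x /mem_drop; apply: (allP bitL).
have szL : 2 ^ size L = 2 ^ size D * 2 ^ j.+1.
  by rewrite -expnD /D size_drop subnK.
have bvL : packed L = packed T * 2 ^ (size D).+1 + (b * 2 ^ size D + packed D).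
  by rewrite {1}defL packed_cat /= -cat1s packed_cat.
have ltD := packed_lt bitD.
have b1 : b <= 1 by apply: (allP bitL); apply: mem_nth.
have -> : packed L * 2 ^ j = packed T * 2 ^ size L + (b * 2 ^ size D + packed D) * 2 ^ j.
  by rewrite szL bvL !expnS; lia.
rewrite modnMDl modn_small; last first.
  by rewrite szL expnS mulnA ltn_pmul2r ?expn_gt0 //; nia.
have -> : 2 * ((b * 2 ^ size D + packed D) * 2 ^ j) = b * 2 ^ size L + packed D * 2 ^ j.+1.
  by rewrite szL expnS; lia.
rewrite divnMDl ?expn_gt0 // divn_small ?addn0 //.
by rewrite szL ltn_pmul2r ?expn_gt0.
Qed.

(** Reading bits inverts packing them, so packing is injective; both index sets have [2 ^ n]
    elements, so it is a bijection. *)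
Lemma sum_words n (F : {ffun 'I_n -> bool} -> nat) :
  \sum_(c < 2 ^ n) F [ffun j : 'I_n => top_bit n c j == 1] = \sum_g F g.
Proof.
pose word (g : {ffun 'I_n -> bool}) := [seq nat_of_bool (g i) | i <- enum 'I_n].
have size_word g : size (word g) = n by rewrite size_map size_enum_ord.
have bit_word g : all (fun b => b <= 1) (word g).
  by apply/allP => _ /mapP[i _ ->]; case: (g i).
have lt_word g : packed (word g) < 2 ^ n by have := packed_lt (bit_word g); rewrite size_word.
pose code g : 'I_(2 ^ n) := Ordinal (lt_word g).
have codeK : cancel code (fun c : 'I_(2 ^ n) => [ffun j : 'I_n => top_bit n c j == 1]).
  move=> g; apply/ffunP=> j; rewrite ffunE /=.
  have := top_bit_packed (bit_word g) (j := j); rewrite size_word => -> //.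
  rewrite (nth_map j) ?size_enum_ord // nth_ord_enum.
  by case: (g j).
rewrite (reindex code) /=; first by apply: eq_bigr => g _; rewrite codeK.
apply: onW_bij; apply: inj_card_bij (can_inj codeK) _.
by rewrite card_ffun card_bool !card_ord.
Qed.

Lemma nth_allpairs (S T R : Type) (f : S -> T -> R) (s : seq S) (t : seq T) x0 y0 z0 x y :
  x < size s -> y < size t ->
  nth z0 [seq f x y | x <- s, y <- t] (x * size t + y) = f (nth x0 s x) (nth y0 t y).
Proof.
move=> + lty; elim: s x => [//|a s IH] [|x] /= ltx; rewrite nth_cat size_map.
  by rewrite mul0n add0n lty (nth_map y0).
by rewrite mulSn -addnA ltnNge leq_addr /= addKn IH.
Qed.

Definition adj_word n (a : 'I_n -> 'I_n -> bool) : seq nat :=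
  [seq nat_of_bool (a i j) | i <- enum 'I_n, j <- enum 'I_n].

Lemma size_adj_word n (a : 'I_n -> 'I_n -> bool) : size (adj_word a) = n * n.
Proof. by rewrite size_allpairs size_enum_ord. Qed.

Lemma bit_adj_word n (a : 'I_n -> 'I_n -> bool) : all (fun b => b <= 1) (adj_word a).
Proof. by apply/allP => _ /allpairsP[[i j] [_ _ ->]]; case: (a _ _). Qed.

Lemma sumn_adj_word n (a : 'I_n -> 'I_n -> bool) : sumn (adj_word a) = \sum_i \sum_j a i j.
Proof.
rewrite sumnE big_allpairs_dep /= big_enum /=; apply: eq_bigr => i _.
by rewrite big_enum.
Qed.

Lemma adj_bit_adj_word n (a : 'I_n -> 'I_n -> bool) (i j : 'I_n) :
  adj_bit n (packed (adj_word a)) i j = a i j.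
Proof.
have := top_bit_packed (bit_adj_word a) (j := i * n + j); rewrite size_adj_word /adj_bit => ->.
  have := nth_allpairs (fun i j => nat_of_bool (a i j)) (s := enum 'I_n)
    (t := enum 'I_n) i j 0 (x := i) (y := j).
  by rewrite size_enum_ord => -> //; rewrite !nth_ord_enum.
by have := ltn_ord i; have := ltn_ord j; nia.
Qed.

(** Distributing the product of two-term sums amounts to choosing for each row a side [f i]; the
    words [c] are the functions [g]. *)
Lemma weight_sum_expand n (a : 'I_n -> 'I_n -> bool) :
  weight_sum n (packed (adj_word a)) (2 ^ n) =
  \sum_(g : {ffun 'I_n -> bool}) \sum_(f : {ffun 'I_n -> bool})
    base n ^ (\sum_i \sum_j (a i j && (g j == f i))).
Proof.
rewrite -(sum_words (fun g : {ffun 'I_n -> bool} => \sum_(f : {ffun 'I_n -> bool})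
    base n ^ (\sum_i \sum_j (a i j && (g j == f i))))).
apply: eq_bigr => c _.
under eq_bigr do rewrite expn_sum.
rewrite -(bigA_distr_bigA (fun i b => base n ^ (\sum_j (a i j && (_ == b))))) /=.
apply: eq_bigr => i _; rewrite big_bool /row_factor /uncut_in /uncut_out; congr (_ ^ _ + _ ^ _);
  apply: eq_bigr => j _; rewrite adj_bit_adj_word ffunE; have := top_bit_le1 n c j;
  by case: (top_bit n c j) => [|[|]] //; case: (a i j).
Qed.

(** Induction from the low end: the digit at [k] and a smaller tail stay below
    [(d k).+1 * X ^ (m - k)], and [d k < X]. *)
Lemma low_digits_lt X m (d : nat -> nat) k : (forall i, d i < X) -> k <= m.+1 ->
  \sum_(k <= i < m.+1) d i * X ^ (m - i) < X ^ (m.+1 - k).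
Proof.
move=> ltd; have X_gt0 : 0 < X by apply: leq_ltn_trans (ltd 0).
move: {2}(m.+1 - k) (erefl (m.+1 - k)) => r; elim: r k => [|r IH] k kr lek.
  by rewrite big_geq ?kr //; lia.
have ltk : k < m.+1 by lia.
rewrite big_ltn // subSn //.
have := IH k.+1; rewrite subSS => /(_ _ ltk) lt.
have {}lt := lt ltac:(lia).
rewrite expnS; have := leq_mul (ltd k) (leqnn (X ^ (m - k))); rewrite mulSn; lia.
Qed.

(** After scaling by [X ^ k], all digits before [k] contribute multiples of [X ^ m.+1], while the
    rest stays below it. *)
Lemma digits_base X m (d : nat -> nat) W :
  (forall i, d i < X) -> W = \sum_(0 <= i < m.+1) d i * X ^ (m - i) ->
  forall k, k <= m -> W * X ^ k %% X ^ m.+1 * X %/ X ^ m.+1 = d k.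
Proof.
move=> ltd defW k lek.
have X_gt0 : 0 < X by apply: leq_ltn_trans (ltd 0).
have H_gt0 : 0 < X ^ m.+1 by rewrite expn_gt0 X_gt0.
pose lo k := \sum_(k <= i < m.+1) d i * X ^ (m - i).
have ltlo j : j <= m.+1 -> lo j * X ^ j < X ^ m.+1.
  move=> lej; have -> : X ^ m.+1 = X ^ (m.+1 - j) * X ^ j by rewrite -expnD subnK.
  by rewrite ltn_pmul2r ?expn_gt0 ?X_gt0 //; apply: low_digits_lt.
have -> : W * X ^ k %% X ^ m.+1 = lo k * X ^ k.
  rewrite defW (big_cat_nat (n := k)) //=; last exact: leqW.
  rewrite mulnDl -modnDml (_ : _ * X ^ k %% _ = 0) ?add0n.
    by rewrite modn_small // ltlo // leqW.
  apply/eqP; rewrite -/(dvdn _ _) big_distrl /= big_nat_cond; apply: dvdn_sum => i.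
  rewrite andbT => /andP[_ ltik]; rewrite -mulnA -expnD dvdn_mull // dvdn_exp2l //; lia.
rewrite {1}/lo big_ltn // -/(lo k.+1) -mulnA -expnSr mulnDl -mulnA -expnD.
rewrite (_ : m - k + k.+1 = m.+1); last by lia.
by rewrite divnMDl // divn_small ?addn0 // ltlo.
Qed.

(** * Enumerated parts, edges and cuts *)

Definition enumerates n (T : finType) (A : {set T}) (v : 'I_n -> T) : Prop :=
  [/\ injective v, forall i, v i \in A & forall x, x \in A -> exists i, x = v i].

(** The equation on [enum A] ties the indices to the order in which [encode] lists the matrix. *)
Lemma exists_enumeration n (T : finType) (A : {set T}) : #|A| = n ->
  exists2 v : 'I_n -> T, enumerates A v & enum A = [seq v i | i <- enum 'I_n].
Proof.
move=> <- {n}; exists (@enum_val T (mem A)).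
  split; [exact: enum_val_inj | exact: enum_valP |].
  by move=> x Ax; exists (enum_rank_in Ax x); rewrite enum_rankK_in.
(* [nth] needs a default element, so the empty set is treated apart. *)
case: (pickP (mem A)) => [x0 Ax0|A0].
  apply: (@eq_from_nth _ x0); first by rewrite size_map size_enum_ord cardE.
  move=> i lti; have lti' : i < #|A| by rewrite cardE.
  rewrite (nth_map (Ordinal lti')) ?size_enum_ord // (enum_val_nth x0).
  by rewrite (nth_ord_enum _ (Ordinal lti')).
have card0 : #|A| = 0 by apply: eq_card0.
have -> : enum A = [::] by apply/nilP; rewrite /nilp -cardE card0.
by apply/esym/nilP; rewrite /nilp size_map size_enum_ord card0.
Qed.

Lemma sum_by_value (T : finType) (c : T -> nat) (F : nat -> nat) m :
  (forall x, c x <= m) ->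
  \sum_x F (c x) = \sum_(0 <= k < m.+1) #|[set x | c x == k]| * F k.
Proof.
move=> lec; rewrite big_mkord.
rewrite (partition_big (fun x => inord (c x) : 'I_m.+1) xpredT) //=.
apply: eq_bigr => k _; rewrite -sum1_card big_distrl /=.
apply: eq_big => [x|x /eqP <-].
  by rewrite inE -val_eqE /= inordK // ltnS.
by rewrite mul1n inordK // ltnS.
Qed.


Lemma enumerates_disjoint n (G : bigraph) (v1 v2 : 'I_n -> vertex G) i j :
  enumerates (part1 G) v1 -> enumerates (part2 G) v2 -> v1 i != v2 j.
Proof.
move=> [_ v1P _] [_ v2P _]; apply/eqP => e.
have := parts_disjoint G; rewrite disjoints_subset => /subsetP/(_ _ (v1P i)).
by rewrite e inE v2P.
Qed.

(** Sending [(i, j)] to the pair [{v1 i, v2 j}] is injective because the parts are disjoint, and it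
    reaches every edge. *)
Lemma card_edge_set n (G : bigraph) (v1 v2 : 'I_n -> vertex G) (Q : {set {set vertex G}}) :
  enumerates (part1 G) v1 -> enumerates (part2 G) v2 -> Q \subset edges G ->
  #|Q| = \sum_i \sum_j ([set v1 i; v2 j] \in Q).
Proof.
move=> en1 en2 sQ; have v12 i j := enumerates_disjoint i j en1 en2.
case: (en1) => [inj1 _ onto1]; case: (en2) => [inj2 _ onto2].
pose h (p : 'I_n * 'I_n) := [set v1 p.1; v2 p.2].
have h_inj : injective h.
  move=> [i j] [i' j']; rewrite /h /= => e; congr (_, _).
    have: v1 i \in [set v1 i'; v2 j'] by rewrite -e set21.
    by rewrite !inE (negPf (v12 _ _)) orbF => /eqP/inj1.
  have: v2 j \in [set v1 i'; v2 j'] by rewrite -e set22.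
  by rewrite !inE eq_sym (negPf (v12 _ _)) /= => /eqP/inj2.
have -> : Q = h @: [set p | h p \in Q].
  apply/setP=> e; apply/idP/imsetP => [Qe|[p]]; last by rewrite inE => ? ->.
  have [x [y [/onto1[i ->] /onto2[j ->] defe]]] := edges_across (subsetP sQ e Qe).
  by exists (i, j) => //; rewrite inE /h /= -defe.
rewrite card_imset // -sum1_card pair_big /= big_mkcond.
apply: eq_bigr => p _; rewrite inE.
by rewrite (mem_imset _ _ h_inj) inE; case: (h p \in Q).
Qed.

Lemma pair_in_cut n (G : bigraph) (v1 v2 : 'I_n -> vertex G) (S : {set vertex G}) i j :
  ([set v1 i; v2 j] \in cut S (~: S)) =
  ([set v1 i; v2 j] \in edges G) && ((v2 j \in S) != (v1 i \in S)).
Proof.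
rewrite inE; congr (_ && _); apply/idP/idP.
  case/existsP=> x /andP[Sx /existsP[y /andP[]]]; rewrite inE => Sy /eqP e.
  have: x \in [set v1 i; v2 j] by rewrite e set21.
  have: y \in [set v1 i; v2 j] by rewrite e set22.
  by rewrite !inE => /orP[]/eqP ey /orP[]/eqP ex; move: Sx Sy; rewrite ex ey => ->; case: (_ \in S).
case S1: (v1 i \in S); case S2: (v2 j \in S) => // _.
  apply/existsP; exists (v1 i); rewrite S1; apply/existsP; exists (v2 j).
  by rewrite inE S2 eqxx.
(* Here [v2 j] is the endpoint in [S], so the pair is read in the other order. *)
apply/existsP; exists (v2 j); rewrite S2; apply/existsP; exists (v1 i).
by rewrite inE S1 setUC eqxx.
Qed.

Lemma sum_uncut n (G : bigraph) (v1 v2 : 'I_n -> vertex G) (S : {set vertex G}) :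
  enumerates (part1 G) v1 -> enumerates (part2 G) v2 ->
  \sum_i \sum_j (([set v1 i; v2 j] \in edges G) && ((v2 j \in S) == (v1 i \in S))) =
  #|edges G| - #|cut S (~: S)|.
Proof.
move=> en1 en2; rewrite (card_edge_set en1 en2 (subxx _)).
rewrite (card_edge_set en1 en2 (_ : cut S (~: S) \subset _)); last first.
  by apply/subsetP => e; rewrite inE => /andP[].
apply/esym/eqP; rewrite -(eqn_add2r (\sum_i \sum_j ([set v1 i; v2 j] \in cut S (~: S)))).
have split_sum : \sum_i \sum_j ([set v1 i; v2 j] \in edges G) =
    \sum_i \sum_j (([set v1 i; v2 j] \in edges G) && ((v2 j \in S) == (v1 i \in S))) +
    \sum_i \sum_j ([set v1 i; v2 j] \in cut S (~: S)).
  rewrite -big_split; apply: eq_bigr => i _; rewrite -big_split; apply: eq_bigr => j _.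
  by rewrite pair_in_cut; case: (_ \in edges G); case: (_ == _).
by rewrite split_sum addnK.
Qed.

Lemma card_vertex n (G : bigraph) : #|part1 G| = n -> #|part2 G| = n ->
  #|vertex G| = n + n.
Proof.
move=> card1 card2; rewrite -cardsT -(parts_cover G) cardsU card1 card2.
by have := parts_disjoint G; rewrite -setI_eq0 => /eqP->; rewrite cards0 subn0.
Qed.

(** A set is determined by its traces since the parts cover all vertices, and there are
    [2 ^ (n + n)] sets as well as pairs of traces. *)
Lemma sum_traces n (G : bigraph) (v1 v2 : 'I_n -> vertex G)
    (F : {ffun 'I_n -> bool} -> {ffun 'I_n -> bool} -> nat) :
  #|part1 G| = n -> #|part2 G| = n ->
  enumerates (part1 G) v1 -> enumerates (part2 G) v2 ->
  \sum_g \sum_f F g f = \sum_(S : {set vertex G}) F [ffun j => v2 j \in S] [ffun i => v1 i \in S].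
Proof.
move=> card1 card2 [_ _ onto1] [_ _ onto2].
pose h (S : {set vertex G}) := ([ffun j => v2 j \in S], [ffun i => v1 i \in S]).
rewrite pair_big /= (reindex h) //=; apply: onW_bij; apply: inj_card_bij.
  move=> S S' [/ffunP e2 /ffunP e1]; apply/setP=> x.
  have: x \in part1 G :|: part2 G by rewrite parts_cover.
  case/setUP => [/onto1[i ->]|/onto2[j ->]].
    by have := e1 i; rewrite !ffunE.
  by have := e2 j; rewrite !ffunE.
rewrite card_prod !card_ffun card_bool card_ord -cardsT -powersetT card_powerset cardsT.
by rewrite (card_vertex card1 card2) expnD.
Qed.

Lemma cut_count_lt n (G : bigraph) k : #|part1 G| = n -> #|part2 G| = n ->
  cut_count G k < base n.
Proof.
move=> card1 card2; rewrite /base addn1 -(card_vertex card1 card2).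
apply: leq_ltn_trans (max_card _) _.
by rewrite -cardsT -powersetT card_powerset cardsT ltn_exp2l.
Qed.

(** The two traces merge into one set [S], and grouping the sets by cut size collects equal
    powers. *)
Lemma weight_sum_cut n (G : bigraph) (v1 v2 : 'I_n -> vertex G) :
  #|part1 G| = n -> #|part2 G| = n ->
  enumerates (part1 G) v1 -> enumerates (part2 G) v2 ->
  weight_sum n (packed (adj_word (fun i j => [set v1 i; v2 j] \in edges G))) (2 ^ n) =
  \sum_(0 <= k < #|edges G|.+1) cut_count G k * base n ^ (#|edges G| - k).
Proof.
move=> card1 card2 en1 en2; rewrite weight_sum_expand (sum_traces _ card1 card2 en1 en2).
rewrite -(sum_by_value (c := fun S : {set vertex G} => #|cut S (~: S)|)
  (fun k => base n ^ (#|edges G| - k))).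
  apply: eq_bigr => S _; rewrite -(sum_uncut S en1 en2); congr (_ ^ _).
  by apply: eq_bigr => i _; apply: eq_bigr => j _; rewrite !ffunE.
by move=> S; apply: subset_leq_card; apply/subsetP => e; rewrite inE => /andP[].
Qed.

Definition cut_code : cmd := Seq read_code (Seq sum_code print_code).

Lemma run_cut_code n (G : bigraph) : #|part1 G| = n -> #|part2 G| = n ->
  exists l, run (maxval n) cut_code (read_time n + (sum_time n + print_time n))
    (nseq 22 0, encode G, [::]) (l, [::], cut_vector G).
Proof.
move=> card1 card2.
have [v1 en1 enum1] := exists_enumeration card1.
have [v2 en2 enum2] := exists_enumeration card2.
pose a i j := [set v1 i; v2 j] \in edges G.
have encE : encode G = n :: adj_word a.
  by rewrite /encode card1 enum1 enum2 allpairs_mapl allpairs_mapr.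
have mE : sumn (adj_word a) = #|edges G|.
  by rewrite sumn_adj_word (card_edge_set en1 en2 (subxx _)).
have lem : #|edges G| <= n * n.
  by rewrite -mE -(size_adj_word a) sumn_bits_le ?bit_adj_word.
have ltE : packed (adj_word a) < 2 ^ (n * n).
  by have := packed_lt (bit_adj_word a); rewrite size_adj_word.
have WE := weight_sum_cut card1 card2 en1 en2.
have ltd k := cut_count_lt k card1 card2.
set W := weight_sum _ _ _ in WE.
have ltW : W < base n ^ #|edges G|.+1.
  by rewrite WE; have := low_digits_lt ltd (leq0n #|edges G|.+1); rewrite subn0.
eexists; rewrite encE.
apply: run_seq (leqnn _); first exact: run_read (size_adj_word a) (bit_adj_word a).
apply: run_seq (leqnn _); first exact: run_sum.
rewrite mE.
have -> : cut_vector G = [seq digit n #|edges G| W k | k <- iota 0 #|edges G|.+1].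
  apply/eq_in_map => k; rewrite mem_iota add0n ltnS => lek.
  by rewrite /digit (digits_base ltd WE lek).
exact: run_print.
Qed.

(** * Polynomial bound on the running time *)

Definition poly_bounded (f : nat -> nat) : Prop :=
  exists c d, forall n, 0 < n -> f n <= c * n ^ d.

Lemma poly_bounded_const k : poly_bounded (fun=> k).
Proof. by exists k, 0 => n _; rewrite muln1. Qed.

Lemma poly_bounded_id : poly_bounded id.
Proof. by exists 1, 1 => n _; rewrite mul1n. Qed.

(** The exponent [d + d'] dominates both exponents because [n > 0]. *)
Lemma poly_boundedD f g :
  poly_bounded f -> poly_bounded g -> poly_bounded (fun n => f n + g n).
Proof.
move=> [c [d lef]] [c' [d' leg]]; exists (c + c'), (d + d') => n n0.
rewrite mulnDl leq_add // (leq_trans (lef n n0), leq_trans (leg n n0)) //.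
  by rewrite leq_mul2l leq_pexp2l ?leq_addr ?orbT.
by rewrite leq_mul2l leq_pexp2l ?leq_addl ?orbT.
Qed.

Lemma poly_boundedM f g :
  poly_bounded f -> poly_bounded g -> poly_bounded (fun n => f n * g n).
Proof.
move=> [c [d lef]] [c' [d' leg]]; exists (c * c'), (d + d') => n n0.
by rewrite expnD mulnACA leq_mul // (lef, leg).
Qed.

Definition cut_time n :=
  (read_time n + (sum_time n + print_time n)) * (2 * len (maxval n)).

Lemma Ostar_cut_time : Ostar cut_time (fun n => 2 ^ n).
Proof.
(* The cofactor of [2 ^ n]: the additive 4 of [sum_time] is at most [4 * 2 ^ n] and joins the 3. The
   square is spelled out as a product for [poly_boundedM]. *)
pose f n := (read_time n + (subset_time n + 7 + print_time n)) *
  (2 * ((2 * n + 2) * ((n + 1) * (n + 1)) + 3)).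
have [c [d lef]] : poly_bounded f.
  rewrite /f /read_time /subset_time /row_time /cell_time /print_time /digit_time.
  by repeat first [exact: poly_bounded_const | exact: poly_bounded_id
    | apply: poly_boundedD | apply: poly_boundedM].
exists c, d, 1 => n n0; apply: leq_trans (leq_mul (lef n n0) (leqnn (2 ^ n))).
have lenE : len (maxval n) = (2 * n + 2) * ((n + 1) * (n + 1)) + 3.
  by rewrite /len /maxval trunc_expnK // -mulnn addn3 addn2.
rewrite /cut_time /f lenE mulnAC leq_mul2r; apply/orP; right.
have p_gt0 : 0 < 2 ^ n by rewrite expn_gt0.
(* With [2 ^ n] abstracted to a positive number, only polynomial arithmetic remains. *)
rewrite /sum_time; move: (2 ^ n) (read_time n) (subset_time n) (print_time n) p_gt0.
by move=> p r s q p_gt0; nia.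
Qed.

Theorem theorem2 :
  exists (P : program) (T : nat -> nat),
    Ostar T (fun n => 2 ^ n) /\
    forall (n : nat) (G : bigraph),
      #|part1 G| = n -> #|part2 G| = n ->
      computes_within P (encode G) (cut_vector G) (T n).
Proof.
exists (compile 0 cut_code), cut_time; split; first exact: Ostar_cut_time.
move=> n G card1 card2; have [l R] := run_cut_code card1 card2.
exact: run_computes R.
Qed.
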